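(* Let $F\subset\mathbb{R}^2$ be a convex polygon with nonempty interior and cyclic vertices $v_1,\dots,v_q$, $v_{q+1}=v_1$. Let $X_m=\{\xi_1^m,\dots,\xi_{M_m}^m\}$ be a finite $\eta_m$-net of $F\times O(2)$ (with respect to $d_X$), with $\xi_j^m=(x_j,Q_j)$, and define the transformed edge endpoints $a_{jk}:=Q_j^{T}(v_k-x_j)$ and $b_{jk}:=Q_j^{T}(v_{k+1}-x_j)$. Then the optimal value of the mixed-integer second-order cone program $$\begin{aligned}\min_{\Delta,p,z,\lambda}\quad&\Delta\\ \text{subject to}\quad& p_0=0,\\ &\|p_r-p_s\|_2\le\Delta,&&0\le r<s\le M_m,\\ &p_j=\sum_{k=1}^{q}\big[(z_{jk}-\lambda_{jk})a_{jk}+\lambda_{jk}b_{jk}\big],&&1\le j\le M_m,\\ &\sum_{k=1}^{q}z_{jk}=1,&&1\le j\le M_m,\\ &0\le\lambda_{jk}\le z_{jk},\quad z_{jk}\in\{0,1\},&&1\le j\le M_m,\ 1\le k\le q\end{aligned}$$ is exactly $D_m$.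
   Context: $O(2)$ is the full orthogonal group of $\mathbb{R}^2$. On $F\times O(2)$ use the metric $d_X((x,Q),(y,P)):=\|x-y\|+\operatorname{diam}(F)\,\|Q-P\|_{\mathrm{op}}$ (Euclidean norm and operator norm). A finite $\eta$-net is a finite subset such that every point of $F\times O(2)$ is within $d_X$-distance at most $\eta$ of it. Put $\mathcal{N}_j^m:=Q_j^{T}(\partial F-x_j)$ for $\xi_j^m=(x_j,Q_j)$. For points $p_j\in\mathcal{N}_j^m$ ($1\le j\le M_m$) and a permutation $\pi$ of $\{1,\dots,M_m\}$, let $\Gamma_{\pi,p}$ be the closed polygonal tour $[0,p_{\pi(1)}]\cup\bigcup_{k=1}^{M_m-1}[p_{\pi(k)},p_{\pi(k+1)}]\cup[p_{\pi(M_m)},0]$. The sampled minimum-diameter traveling salesman problem with neighborhoods has optimal value $$D_m:=\min_{\pi,\ p_j\in\mathcal{N}_j^m}\operatorname{diam}\Gamma_{\pi,p}=\min_{p_j\in\mathcal{N}_j^m}\ \max_{0\le r<s\le M_m}\|p_r-p_s\|,\qquad p_0:=0.$$ *)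

(* Defs.v *)
From HB Require Import structures.
From mathcomp Require Import all_boot all_order all_algebra all_fingroup.
From mathcomp Require Import all_classical all_reals all_analysis.

Set Implicit Arguments.
Unset Strict Implicit.
Unset Printing Implicit Defensive.

Import Order.TTheory GRing.Theory Num.Theory.
Import numFieldNormedType.Exports.

Local Open Scope classical_set_scope.
Local Open Scope ring_scope.

Section Plane.
Variable R : realType.
Implicit Types (x y : 'cV[R]_2) (A F S : set 'cV[R]_2) (Q : 'M[R]_2).

Definition dotp x y : R := \sum_i x i 0 * y i 0.

(* The canonical norm `|x| on matrices is the sup norm, hence a Euclidean norm
   of our own.  The canonical topology on 'cV[R]_2 is the usual one. *)
Definition enorm x : R := Num.sqrt (dotp x x).

Definition opnorm Q : R := sup [set enorm (Q *m x) | x in [set x | enorm x <= 1]].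

Definition diam A : R :=
  sup [set d | exists x y, [/\ A x, A y & d = enorm (x - y)]].

Definition segment x y : set 'cV[R]_2 :=
  [set (1 - t) *: x + t *: y | t in [set t : R | 0 <= t <= 1]].

Definition boundary A : set 'cV[R]_2 := closure A `\` interior A.

Definition convex_hull (n : nat) (v : 'I_n -> 'cV[R]_2) : set 'cV[R]_2 :=
  [set x | exists w : 'I_n -> R,
     [/\ forall k, 0 <= w k, \sum_k w k = 1 & x = \sum_k w k *: v k]].

(* Faces of a polytope, in the sense of valid linear inequalities.  Taking
   c = 0 and d = 0 gives F itself. *)
Definition face F S : Prop := exists (c : 'cV[R]_2) (d : R),
  (forall x, F x -> dotp c x <= d) /\ S = F `&` [set x | dotp c x = d].

Definition vertices F : set 'cV[R]_2 := [set x | face F [set x]].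

(* F is the convex polygon whose distinct vertices, listed in cyclic order, are
   v_0, ..., v_(q-1): consecutive vertices are the endpoints of an edge, that
   is, of a one-dimensional face; ordS is the successor modulo q. *)
Record convex_polygon F (q : nat) (v : 'I_q -> 'cV[R]_2) : Prop := {
  polygon_hull : F = convex_hull v ;
  polygon_interior : interior F !=set0 ;
  polygon_vertices : vertices F = range v ;
  polygon_uniq : injective v ;
  polygon_edges : forall k, face F (segment (v k) (v (ordS k)))
}.

Definition O2 : set 'M[R]_2 := [set Q | Q^T *m Q = 1%:M].

Definition dX F (u w : 'cV[R]_2 * 'M[R]_2) : R :=
  enorm (u.1 - w.1) + diam F * opnorm (u.2 - w.2).

Definition finite_net F (eta : R) (X : set ('cV[R]_2 * 'M[R]_2)) : Prop :=
  [/\ finite_set X, X `<=` F `*` O2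
    & forall u, (F `*` O2) u -> exists2 w, X w & dX F u w <= eta].

Definition neighborhood F (xi : 'cV[R]_2 * 'M[R]_2) : set 'cV[R]_2 :=
  [set xi.2^T *m (y - xi.1) | y in boundary F].

Definition is_min (A : set R) (a : R) : Prop := A a /\ lbound A a.

End Plane.

(* Points p_1, ..., p_M are indexed by 'I_M; the families p_0, ..., p_M with
   p_0 = 0 are indexed by 'I_M.+1, where p_j becomes p (lift ord0 j). *)
Section Tours.
Variables (R : realType) (M : nat).
Implicit Types (p : 'I_M -> 'cV[R]_2) (N : 'I_M -> set 'cV[R]_2).

Definition tour (s : {perm 'I_M}) p : set 'cV[R]_2 :=
  [set x | (exists k : 'I_M, k = 0%N :> nat /\ segment 0 (p (s k)) x)
    \/ (exists k l : 'I_M, l = k.+1 :> nat /\ segment (p (s k)) (p (s l)) x)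
    \/ (exists k : 'I_M, k.+1 = M /\ segment (p (s k)) 0 x)].

Definition tour_diameters N : set R :=
  [set d | exists (s : {perm 'I_M}) p,
     (forall j, N j (p j)) /\ d = diam (tour s p)].

Definition with_origin p (r : 'I_M.+1) : 'cV[R]_2 :=
  if unlift ord0 r is Some j then p j else 0.

Definition max_distances N : set R :=
  [set d | exists p, (forall j, N j (p j)) /\
     d = \big[Num.max/0]_(r < M.+1) \big[Num.max/0]_(s < M.+1 | (r < s)%N)
           enorm (with_origin p r - with_origin p s)].

Definition min_diameter_value N : R := inf (tour_diameters N).

End Tours.

Section Program.
Variables (R : realType) (M q : nat) (a b : 'I_M -> 'I_q -> 'cV[R]_2).

Record misocp_feasible (Delta : R) (p : 'I_M.+1 -> 'cV[R]_2)
    (z lambda : 'I_M -> 'I_q -> R) : Prop := {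
  misocp_origin : p ord0 = 0 ;
  misocp_cone : forall r s : 'I_M.+1, (r < s)%N -> enorm (p r - p s) <= Delta ;
  misocp_point : forall j, p (lift ord0 j) =
    \sum_k ((z j k - lambda j k) *: a j k + lambda j k *: b j k) ;
  misocp_select : forall j, \sum_k z j k = 1 ;
  misocp_lambda : forall j k, 0 <= lambda j k <= z j k ;
  misocp_binary : forall j k, z j k = 0 \/ z j k = 1
}.

Definition misocp_values : set R :=
  [set Delta | exists p z lambda, misocp_feasible Delta p z lambda].

End Program.

(* Main.v *)
Require Import Defs.
From HB Require Import structures.
From mathcomp Require Import all_boot all_order all_algebra all_fingroup.
From mathcomp Require Import all_classical all_reals all_analysis.
From mathcomp Require Import ring lra.

Set Implicit Arguments.
Unset Strict Implicit.
Unset Printing Implicit Defensive.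

Import Order.TTheory GRing.Theory Num.Theory.
Import numFieldNormedType.Exports.

Local Open Scope classical_set_scope.
Local Open Scope ring_scope.

(** Three identifications prove the theorem.

    - The boundary of the polygon is the union of its edges
      ([polygon_boundary]), hence each neighborhood is the union of the
      transformed segments [a_jk, b_jk] ([neighborhoodE]).  Binary variables z
      with sum 1 select one of these segments and lambda is the affine parameter
      on it, so the feasible values of the program are the upper bounds of the
      distances between points of admissible families ([misocp_valuesE]).

    - The diameter of a polygonal tour is the largest distance between two of
      its vertices, because the distance to a fixed point is convex along each
      segment ([diam_tour]).  It does not depend on the order of the visits,
      and the two sets of values in the definition of the optimum coincide
      ([tour_diametersE]).

    - Neighborhoods are finite unions of segments, hence compact, and the
      largest distance depends continuously on the family of points, so the
      minimum is attained ([spread_attained]).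

    The geometric core is the first point: a polygon F given as a convex hull,
    such that consecutive vertices span faces, is the intersection of the
    half-planes of these edges ([polygon_halfplanes]).  The edges turn in one
    direction ([polygon_turns]), so, seen from an interior point x, all triangles
    (x, v_k, v_(k+1)) have the same orientation.  A point y in all the
    half-planes lies in one of the angular sectors at x over an edge
    ([cone_selection]), and the half-plane of this edge puts y in the
    triangle. *)

(** * Plane vectors *)

Section PlaneAlgebra.
Context {R : realType}.
Implicit Types (x y a b c e u w : 'cV[R]_2) (t d : R).

Lemma dotpE x y : dotp x y = x 0 0 * y 0 0 + x 1 0 * y 1 0.
Proof.
rewrite /dotp !big_ord_recl big_ord0 addr0.
by congr (_ + x _ _ * y _ _); exact/val_inj.
Qed.

Lemma dotpDr c x y : dotp c (x + y) = dotp c x + dotp c y.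
Proof. by rewrite !dotpE !mxE; ring. Qed.

Lemma dotpBr c x y : dotp c (x - y) = dotp c x - dotp c y.
Proof. by rewrite !dotpE !mxE; ring. Qed.

Lemma dotpZr c t x : dotp c (t *: x) = t * dotp c x.
Proof. by rewrite !dotpE !mxE; ring. Qed.

Lemma dotpNl c x : dotp (- c) x = - dotp c x.
Proof. by rewrite !dotpE !mxE; ring. Qed.

Lemma dotp_sumr q c (w : 'I_q -> R) (v : 'I_q -> 'cV[R]_2) :
  dotp c (\sum_k w k *: v k) = \sum_k w k * dotp c (v k).
Proof.
elim/big_ind2: _ => [|x s y t <- <-|k _]; last exact: dotpZr.
  by rewrite dotpE !mxE !mulr0 addr0.
by rewrite dotpDr.
Qed.

Lemma cV2P x y : x 0 0 = y 0 0 -> x 1 0 = y 1 0 -> x = y.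
Proof.
move=> h0 h1; apply/matrixP => i j; rewrite ord1.
case: i => -[|[|//]] i2; [have -> : Ordinal i2 = 0 by exact/val_inj|
  have -> : Ordinal i2 = 1 by exact/val_inj]; by [].
Qed.

Lemma dotp_ge0 x : 0 <= dotp x x.
Proof. by rewrite dotpE -!expr2 addr_ge0 ?sqr_ge0. Qed.

Lemma dotp_gt0 x : x != 0 -> 0 < dotp x x.
Proof.
move=> x0; rewrite lt_neqAle dotp_ge0 andbT eq_sym; apply: contra x0 => /eqP.
rewrite dotpE -!expr2 => /eqP; rewrite paddr_eq0 ?sqr_ge0// !sqrf_eq0.
by move=> /andP[/eqP h0 /eqP h1]; apply/eqP/cV2P; rewrite mxE.
Qed.

Definition perp x : 'cV[R]_2 := \col_i (if i == 0 then - x 1 0 else x 0 0).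

Definition cross x y : R := dotp (perp x) y.

Lemma crossE x y : cross x y = x 0 0 * y 1 0 - x 1 0 * y 0 0.
Proof. by rewrite /cross dotpE !mxE /=; ring. Qed.

(** With c normal to an edge, this expansion compares orientations: whenever c
    is orthogonal to a or to b, the sign of cross a b is read off from one
    scalar product and one cross product with c. *)
Lemma cross_lagrange c a b :
  dotp c c * cross a b = dotp c a * cross c b - dotp c b * cross c a.
Proof. by rewrite !dotpE !crossE; ring. Qed.

Lemma dotp_cross_sqr c e :
  dotp c c * dotp e e = dotp c e ^+ 2 + cross c e ^+ 2.
Proof. by rewrite !dotpE !crossE; ring. Qed.

(** Coordinates of u in the basis (w, w'), cleared of the denominator. *)
Lemma cramer w w' u : cross w w' *: u = - cross w' u *: w + cross w u *: w'.
Proof. by apply: cV2P; rewrite !crossE !mxE; ring. Qed.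

Lemma exists_normal a b : exists2 c, c != 0 & dotp c a = dotp c b.
Proof.
have [->|ab] := eqVneq a b.
  exists (const_mx 1) => //; apply/eqP => /matrixP/(_ 0 0)/eqP.
  by rewrite !mxE oner_eq0.
exists (perp (a - b)); last by rewrite !dotpE !mxE /=; ring.
apply: contra ab => /eqP /matrixP h; apply/eqP/cV2P; apply/eqP.
  by have := h 1 0; rewrite !mxE /= => /eqP; rewrite subr_eq0.
by have := h 0 0; rewrite !mxE /= => /eqP; rewrite oppr_eq0 subr_eq0.
Qed.

Lemma segmentl a b : segment a b a.
Proof. by exists 0; rewrite /= ?lexx ?ler01// subr0 scale1r scale0r addr0. Qed.

Lemma segmentr a b : segment a b b.
Proof. by exists 1; rewrite /= ?lexx ?ler01// subrr scale1r scale0r add0r. Qed.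

End PlaneAlgebra.

(** * Convex hulls *)

Section Hull.
Context {R : realType} {q : nat} (v : 'I_q -> 'cV[R]_2).
Implicit Types (x y c : 'cV[R]_2).

Lemma hull_vertex k : convex_hull v (v k).
Proof.
exists (fun i => (i == k)%:R); split.
- by move=> i; rewrite ler0n.
- by rewrite (bigD1 k)//= eqxx big1 ?addr0// => i /negbTE ->.
- rewrite (bigD1 k)//= eqxx scale1r big1 ?addr0// => i /negbTE ->.
  by rewrite scale0r.
Qed.

Lemma hull_triangle x y z (s t : R) : convex_hull v x -> convex_hull v y ->
  convex_hull v z -> 0 <= s -> 0 <= t -> s + t <= 1 ->
  convex_hull v (x + s *: (y - x) + t *: (z - x)).
Proof.
move=> [w [w0 w1 xE]] [w' [w0' w1' yE]] [w'' [w0'' w1'' zE]] s0 t0 st.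
exists (fun k => (1 - s - t) * w k + s * w' k + t * w'' k); split.
- by move=> k; rewrite !addr_ge0// mulr_ge0//; lra.
- by rewrite !big_split/= -!mulr_sumr w1 w1' w1''; lra.
- transitivity ((1 - s - t) *: x + s *: y + t *: z).
    by apply: cV2P; rewrite !mxE; ring.
  rewrite {1}xE {1}yE {1}zE !scaler_sumr -!big_split/=; apply: eq_bigr => k _.
  by rewrite !scalerA !scalerDl.
Qed.

Lemma hull_dotp_eq c d x : (forall k, dotp c (v k) = d) ->
  convex_hull v x -> dotp c x = d.
Proof.
move=> cd [w [_ w1 ->]]; rewrite dotp_sumr.
under eq_bigr do rewrite cd.
by rewrite -mulr_suml w1 mul1r.
Qed.

(** Only strictness needs care: some weight is positive since they sum to 1. *)
Lemma hull_dotp_lt c d x : (forall k, dotp c (v k) < d) ->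
  convex_hull v x -> dotp c x < d.
Proof.
move=> cd [w [w0 w1 ->]]; rewrite dotp_sumr -subr_gt0.
have -> : d - \sum_k w k * dotp c (v k) = \sum_k w k * (d - dotp c (v k)).
  by under [RHS]eq_bigr do rewrite mulrBr; rewrite sumrB -mulr_suml w1 mul1r.
have ge0 k : 0 <= w k * (d - dotp c (v k)).
  by rewrite mulr_ge0// subr_ge0 ltW.
rewrite lt_def sumr_ge0// andbT; apply/eqP => /psumr_eq0P s0.
have /eqP := w1; rewrite big1 ?(eq_sym 0) ?oner_eq0// => k _.
have /eqP := s0 (fun i _ => ge0 i) k isT.
by rewrite mulf_eq0 subr_eq0 (gt_eqF (cd k)) orbF => /eqP.
Qed.

End Hull.

(** * Linear functionals and interiors *)

Section Topology.
Context {R : realType}.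
Implicit Types (x y c : 'cV[R]_2) (F : set 'cV[R]_2).

Lemma dotp_continuous c : continuous (dotp c).
Proof.
move=> x; have -> : dotp c = fun y => c 0 0 * y 0 0 + c 1 0 * y 1 0.
  by apply/funext => y; exact: dotpE.
have cc i : {for x, continuous (fun y : 'cV[R]_2 => c i 0 * y i 0)}.
  by apply: continuousM; [exact: cst_continuous|exact: coord_continuous].
exact: continuousD (cc 0) (cc 1).
Qed.

Lemma nbhs_dotp_lt c d x : dotp c x < d -> nbhs x [set y | dotp c y < d].
Proof. by move=> xd; have := @dotp_continuous c x _ (lt_nbhsl xd). Qed.

(** From an interior point one can still move a little in the direction c. *)
Lemma interior_dotp_increase F x c : interior F x -> c != 0 ->
  exists2 y, F y & dotp c x < dotp c y.
Proof.
move=> Fx c0.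
have line : (fun t : R => x + t *: c) t @[t --> (0 : R)] --> x.
  rewrite -{2}[x]addr0 -(scale0r c).
  by apply: cvgD; [exact: cvg_cst|exact: scalel_continuous].
have /nbhs_ballP[r /= r0 rF] := line _ Fx.
exists (x + (r / 2) *: c).
  by apply: rF; rewrite /ball /= sub0r normrN gtr0_norm ?divr_gt0//; lra.
by rewrite dotpDr dotpZr ltrDl mulr_gt0 ?dotp_gt0// divr_gt0.
Qed.

Lemma interior_strict F c d x : c != 0 -> (forall y, F y -> dotp c y <= d) ->
  interior F x -> dotp c x < d.
Proof.
move=> c0 cd Fx; have [y Fy] := interior_dotp_increase Fx c0.
by move=> /lt_le_trans; apply; exact: cd.
Qed.

Lemma interior_not_collinear F c d : interior F !=set0 -> c != 0 ->
  ~ (forall x, F x -> dotp c x = d).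
Proof.
move=> [x Fx] c0 Fd; have [y Fy] := interior_dotp_increase Fx c0.
by rewrite (Fd _ Fy) (Fd _ (interior_subset Fx)) ltxx.
Qed.

End Topology.

(** * The boundary of a convex polygon *)

Section Polygon.
Context {R : realType} {q : nat}.
Implicit Types (F : set 'cV[R]_2) (v : 'I_q -> 'cV[R]_2).

(** The successor modulo q acts transitively on the indices. *)
Lemma ordS_ind (P : 'I_q -> Prop) k :
  P k -> (forall i, P i -> P (ordS i)) -> forall i, P i.
Proof.
move=> Pk PS i; have q0 : (0 < q)%N by exact: leq_ltn_trans (ltn_ord k).
have iterE n : nat_of_ord (iter n (@ordS q) k) = ((k + n) %% q)%N.
  elim: n => [|n IH]; first by rewrite addn0 modn_small.
  by rewrite iterS /= IH -addn1 modnDml -addnA addn1.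
suff -> : i = iter (i + (q - k)) (@ordS q) k.
  by elim: (i + _)%N => //= n; exact: PS.
apply: val_inj; rewrite /= iterE addnC -addnA subnK ?modnDr ?modn_small//.
exact: ltnW.
Qed.

Lemma polygon_size_gt0 F v : convex_polygon F v -> (0 < q)%N.
Proof.
move=> hF; have [x /interior_subset] := polygon_interior hF.
rewrite (polygon_hull hF) lt0n => -[w [_ + _]].
apply: contra_eq_neq => q0; rewrite big1 ?(eq_sym 0) ?oner_eq0// => k.
by move: (ltn_ord k); rewrite [X in (_ < X)%N]q0.
Qed.

(** The functional c_k defining an edge is nonzero: with c_k = 0 the edge would
    be all of F, and F would lie on a line. *)
Lemma polygon_edge_supports F v : convex_polygon F v ->
  exists (c : 'I_q -> 'cV[R]_2) (d : 'I_q -> R),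
  [/\ forall k, c k != 0,
      forall k x, F x -> dotp (c k) x <= d k
    & forall k, segment (v k) (v (ordS k)) = F `&` [set x | dotp (c k) x = d k]].
Proof.
move=> [_ Fint _ _ edge].
have [c cP] := choice edge; have [d dP] := choice cP.
exists c, d; split=> [k|k x|k]; [|exact: (dP k).1|exact: (dP k).2].
apply/eqP => c0; have [e e0 eab] := exists_normal (v k) (v (ordS k)).
have d0 : d k = 0.
  have : (F `&` [set x | dotp (c k) x = d k]) (v k).
    by rewrite -(dP k).2; exact: segmentl.
  by rewrite c0 => -[_ /= <-]; rewrite dotpE !mxE; ring.
apply: (@interior_not_collinear _ F e (dotp e (v k)) Fint e0) => x Fx.
have : segment (v k) (v (ordS k)) x.
  by rewrite (dP k).2 c0 d0; split=> //=; rewrite dotpE !mxE; ring.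
by move=> [t _ <-]; rewrite dotpDr !dotpZr -eab; ring.
Qed.

(** A functional that is maximal on F only at v_k would, at an inner point of
    the segment, be maximal at both ends too. *)
Lemma polygon_extreme F v x y k : convex_polygon F v -> F x -> F y ->
  segment x y (v k) -> v k = x \/ v k = y.
Proof.
move=> [_ _ Fv _ _] Fx Fy [t /= /andP[t0 t1] vE].
have [c [d [cd sE]]] : vertices F (v k) by rewrite Fv; exists k.
have [_ /= vd] : (F `&` [set x | dotp c x = d]) (v k) by rewrite -sE.
have atv z : F z -> dotp c z = d -> v k = z.
  by move=> Fz zd; symmetry; have : [set v k] z by rewrite sE.
have xd := cd _ Fx; have yd := cd _ Fy.
move: vd; rewrite -vE dotpDr !dotpZr vE => vd.
have [t1'|t1'] := eqVneq t 1; first by right; apply: atv => //; nra.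
left; apply: atv => //; apply/eqP; rewrite eq_le xd /= -subr_le0.
have {}t1' : 0 < 1 - t by rewrite subr_gt0 lt_neqAle t1' t1.
rewrite -(pmulr_rle0 _ t1'); nra.
Qed.

Lemma polygon_vertex_in F v k : convex_polygon F v -> F (v k).
Proof. by move=> [-> _ _ _ _]; exact: hull_vertex. Qed.

(** Otherwise v_(k+2) is v_k or v_(k+1), the successor permutes {k, k+1}, and
    these are all the indices: F would lie on the line through two points. *)
Lemma polygon_next_notin F v k : convex_polygon F v ->
  ~ segment (v k) (v (ordS k)) (v (ordS (ordS k))).
Proof.
move=> hF kS; have Fv i := polygon_vertex_in i hF.
have two i : i = k \/ i = ordS k.
  apply: (@ordS_ind (fun i => i = k \/ i = ordS k) k); first by left.
  move=> {}i [->|->]; first by right.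
  have [/(polygon_uniq hF)->|/(polygon_uniq hF)->] :=
    polygon_extreme hF (Fv k) (Fv (ordS k)) kS; [by left|by right].
have [c c0 cab] := exists_normal (v k) (v (ordS k)).
apply: (interior_not_collinear (polygon_interior hF) c0) => x.
by rewrite (polygon_hull hF); apply: hull_dotp_eq => i; case: (two i) => ->.
Qed.

Lemma polygon_prev_notin F v k : convex_polygon F v ->
  ~ segment (v (ordS k)) (v (ordS (ordS k))) (v k).
Proof.
move=> hF kS; have Fv i := polygon_vertex_in i hF.
have [/(polygon_uniq hF) h|/(polygon_uniq hF) h] :=
    polygon_extreme hF (Fv (ordS k)) (Fv (ordS (ordS k))) kS;
  apply: (polygon_next_notin (k := k) hF); rewrite -?h; exact: segmentl.
Qed.

Section Supports.
Variables (F : set 'cV[R]_2) (v : 'I_q -> 'cV[R]_2).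
Variables (c : 'I_q -> 'cV[R]_2) (d : 'I_q -> R).
Hypothesis hF : convex_polygon F v.
Hypothesis c0 : forall k, c k != 0.
Hypothesis cd : forall k x, F x -> dotp (c k) x <= d k.
Hypothesis edgeE :
  forall k, segment (v k) (v (ordS k)) = F `&` [set x | dotp (c k) x = d k].

Let Fv k : F (v k) := polygon_vertex_in k hF.

Let cvl k : dotp (c k) (v k) = d k.
Proof. by have := segmentl (v k) (v (ordS k)); rewrite edgeE => -[]. Qed.

Let cvr k : dotp (c k) (v (ordS k)) = d k.
Proof. by have := segmentr (v k) (v (ordS k)); rewrite edgeE => -[]. Qed.

Let along_edge k : dotp (c k) (v (ordS k) - v k) = 0.
Proof. by rewrite dotpBr cvl cvr subrr. Qed.

Let off_edge k x : F x -> ~ segment (v k) (v (ordS k)) x ->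
  dotp (c k) x < d k.
Proof.
by move=> Fx xk; rewrite lt_neqAle cd// andbT; apply/eqP => xd; apply: xk;
  rewrite edgeE.
Qed.

(** The polygon turns in one direction.  Let e and e' be consecutive edge
    vectors with normals c and c'.  Since v_(k+2) is strictly inside the
    half-plane of e, and v_k strictly inside that of e', [cross_lagrange] with c
    shows that cross c e and cross e e' have the same sign, and with c' that
    cross e e' and cross c' e' do.  The factor sigma carries the common sign. *)
Lemma polygon_turns : exists sigma : R, forall k,
  0 < sigma * cross (c k) (v (ordS k) - v k).
Proof.
pose k := Ordinal (polygon_size_gt0 hF).
(* Only the sign of sigma matters: the value at one edge serves. *)
exists (cross (c k) (v (ordS k) - v k)); apply: (@ordS_ind _ k).
  rewrite -expr2 lt_neqAle sqr_ge0 andbT eq_sym; apply/eqP => g0.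
  have e0 : v (ordS k) - v k != 0.
    rewrite subr_eq0; apply/eqP => /(polygon_uniq hF) kS.
    by apply: (polygon_next_notin (k := k) hF); rewrite !kS; exact: segmentl.
  have := dotp_cross_sqr (c k) (v (ordS k) - v k).
  rewrite g0 along_edge expr0n /= addr0 => /eqP.
  by rewrite gt_eqF// mulr_gt0 ?dotp_gt0.
set sigma := cross (c k) _ => i IH.
pose e := v (ordS i) - v i; pose e' := v (ordS (ordS i)) - v (ordS i).
have p0 : dotp (c i) e' < 0.
  rewrite dotpBr cvr subr_lt0; apply: off_edge => //.
  exact: (polygon_next_notin hF).
have r0 : 0 < dotp (c (ordS i)) e.
  rewrite dotpBr cvl subr_gt0; apply: off_edge => //.
  exact: (polygon_prev_notin hF).
have L1 := cross_lagrange (c i) e e'.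
have L2 := cross_lagrange (c (ordS i)) e e'.
rewrite along_edge mul0r sub0r in L1; rewrite along_edge mul0r subr0 in L2.
have X0 : 0 < sigma * cross e e'.
  rewrite -(pmulr_rgt0 _ (dotp_gt0 (c0 i))) mulrCA L1 mulrN -mulNr mulrCA.
  by rewrite mulNr -mulrN nmulr_rgt0// mulrN oppr_lt0.
rewrite -/e' -(pmulr_rgt0 _ r0) mulrCA -L2 mulrCA.
by rewrite mulr_gt0// dotp_gt0.
Qed.

(** Seen from x, the values of n at the vertices cannot all have one strict
    sign, because x is a convex combination of the vertices; going round the
    polygon, they must therefore pass from nonnegative to nonpositive.  With n
    normal to a direction u, this finds the edge whose sector contains u. *)
Lemma cone_selection (n x : 'cV[R]_2) : F x ->
  exists2 k, 0 <= dotp n (v k - x) & dotp n (v (ordS k) - x) <= 0.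
Proof.
move=> Fx; apply: contrapT => nk.
have step k : 0 <= dotp n (v k - x) -> 0 < dotp n (v (ordS k) - x).
  by move=> k0; rewrite ltNge; apply/negP => ?; apply: nk; exists k.
have strict m : (forall k, dotp m (v k) < dotp m x) -> False.
  move: Fx; rewrite (polygon_hull hF) => Fx mx.
  by have := hull_dotp_lt mx Fx; rewrite ltxx.
have [[k k0]|none] := pselect (exists k, 0 <= dotp n (v k - x)).
  have pos : forall i, 0 < dotp n (v i - x).
    by apply: (@ordS_ind _ (ordS k) (step _ k0)) => i /ltW; exact: step.
  by apply: (strict (- n)) => i; rewrite !dotpNl ltrN2 -subr_gt0 -dotpBr.
apply: (strict n) => i; rewrite -subr_lt0 -dotpBr ltNge.
by apply/negP => ?; apply: none; exists i.
Qed.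

(** Fix an interior point x.  For y = x + u with u in the sector over the edge k,
    write u = al (v_k - x) + be (v_(k+1) - x) with al, be nonnegative.  The
    functional c_k takes the same positive value on both vectors, so the
    half-plane of the edge k says exactly that al + be <= 1. *)
Lemma polygon_halfplanes : F = [set y | forall k, dotp (c k) y <= d k].
Proof.
apply/seteqP; split=> [x Fx k|y yd]; first exact: cd.
have [sigma turn] := polygon_turns.
have [x xint] := polygon_interior hF; have Fx := interior_subset xint.
pose w k := v k - x; pose u := y - x.
have wE k : dotp (c k) (w k) = d k - dotp (c k) x by rewrite dotpBr cvl.
have wE' k : dotp (c k) (w (ordS k)) = d k - dotp (c k) x.
  by rewrite dotpBr cvr.
have gap k : 0 < d k - dotp (c k) x
  by rewrite subr_gt0; exact: interior_strict (c0 k) (cd k) xint.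
have D0 k : 0 < sigma * cross (w k) (w (ordS k)).
  rewrite -(pmulr_rgt0 _ (dotp_gt0 (c0 k))) mulrCA cross_lagrange wE wE'.
  rewrite -mulrBr mulrCA mulr_gt0// /cross -dotpBr.
  have -> : w (ordS k) - w k = v (ordS k) - v k by rewrite /w opprB addrA subrK.
  exact: turn.
(* This normal n satisfies n . z = sigma * cross z u. *)
have [k k1 k2] := cone_selection (- (sigma *: perp u)) Fx.
have crossN z : dotp (- (sigma *: perp u)) z = sigma * cross z u.
  by rewrite crossE dotpE !mxE /=; ring.
rewrite crossN -/(w _) in k1; rewrite crossN -/(w _) in k2.
have Dk := D0 k; set D := sigma * _ in Dk; have DN : D != 0 by rewrite gt_eqF.
pose al := - (sigma * cross (w (ordS k)) u) / D.
pose be := sigma * cross (w k) u / D.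
have al0 : 0 <= al by rewrite divr_ge0 ?oppr_ge0// ltW.
have be0 : 0 <= be by rewrite divr_ge0// ltW.
have uE : u = al *: w k + be *: w (ordS k).
  apply: (scalerI DN); rewrite [RHS]scalerDr !scalerA /al /be ![D * (_ / D)]mulrC.
  rewrite !divfK// -[LHS]scalerA cramer [LHS]scalerDr !scalerA.
  by rewrite mulrN.
have ab1 : al + be <= 1.
  have : dotp (c k) u <= d k - dotp (c k) x by rewrite dotpBr lerB.
  rewrite uE dotpDr !dotpZr wE wE' -mulrDl => h.
  by rewrite -(ler_pM2r (gap k)) mul1r.
have -> : y = x + al *: w k + be *: w (ordS k) by rewrite -addrA -uE addrC subrK.
move: Fx (Fv k) (Fv (ordS k)); rewrite (polygon_hull hF) => Fx Fk Fk'.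
exact: hull_triangle.
Qed.

End Supports.

(** F is closed, being an intersection of half-planes, and a point strictly
    inside all the finitely many half-planes is interior. *)
Theorem polygon_boundary F v : convex_polygon F v ->
  boundary F = \bigcup_k segment (v k) (v (ordS k)).
Proof.
move=> hF; have [c [d [c0 cd edgeE]]] := polygon_edge_supports hF.
have FE := polygon_halfplanes hF c0 cd edgeE.
apply/seteqP; split=> [x [clx nintx]|x [k _ kx]].
  have Fx : F x.
    suff : closed F by move=> /closure_id ->.
    rewrite FE.
    have -> : [set y | forall k, dotp (c k) y <= d k] =
        \bigcap_k (dotp (c k) @^-1` [set r | r <= d k]).
      by apply/seteqP; split=> y yd k; [move=> _; exact: yd|exact: yd].
    apply: closed_bigI => k _; apply: preimage_closed; last exact: closed_le.
    by move=> y _; exact: dotp_continuous.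
  apply: contrapT => xk; apply: nintx.
  have lt_d k : dotp (c k) x < d k.
    rewrite lt_neqAle cd// andbT; apply/eqP => xd; apply: xk; exists k => //.
    by rewrite edgeE.
  rewrite /interior FE.
  have : nbhs x [set y | forall k, dotp (c k) y < d k].
    apply: (@filter_forall _ _ (fun k y => dotp (c k) y < d k) _
      (nbhs_filter x)) => k; exact: nbhs_dotp_lt.
  by apply: filterS => y yd k; exact: ltW.
move: (kx); rewrite edgeE => -[Fx xd]; split; first exact: subset_closure.
by move=> /(interior_strict (c0 k) (cd k)); rewrite xd ltxx.
Qed.

End Polygon.

(** * Diameters of tours *)

Section Spread.
Context {R : realType} {M : nat}.
Implicit Types (x y a b : 'cV[R]_2) (P : 'I_M.+1 -> 'cV[R]_2)
  (p : 'I_M -> 'cV[R]_2) (N : 'I_M -> set 'cV[R]_2) (m : R).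

Lemma enorm_ge0 x : 0 <= enorm x.
Proof. exact: sqrtr_ge0. Qed.

Lemma enorm0 : enorm (0 : 'cV[R]_2) = 0.
Proof. by rewrite /enorm dotpE !mxE !mulr0 addr0 sqrtr0. Qed.

Lemma enormBC x y : enorm (x - y) = enorm (y - x).
Proof. by rewrite /enorm; congr Num.sqrt; rewrite !dotpE !mxE; ring. Qed.

Lemma enorm_le_sqr x m : 0 <= m -> (enorm x <= m) = (dotp x x <= m ^+ 2).
Proof.
by move=> m0; rewrite /enorm -{1}(ger0_norm m0) -sqrtr_sqr ler_sqrt ?sqr_ge0.
Qed.

Lemma enorm_continuous : continuous (@enorm R).
Proof.
move=> x; apply: (@continuous_comp _ _ _ (fun y : 'cV[R]_2 => dotp y y)
  (@Num.sqrt R)); last exact: sqrt_continuous.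
have -> : (fun y : 'cV[R]_2 => dotp y y) =
    fun y => y 0 0 * y 0 0 + y 1 0 * y 1 0 by apply/funext => y; exact: dotpE.
have cc i : {for x, continuous (fun y : 'cV[R]_2 => y i 0 * y i 0)}.
  by apply: continuousM; exact: coord_continuous.
exact: continuousD (cc 0) (cc 1).
Qed.

(** Balls are convex, by the identity
    |(1 - t) a + t b|^2 = (1 - t) |a|^2 + t |b|^2 - t (1 - t) |a - b|^2. *)
Lemma enorm_segment_le x y a b m : segment a b x ->
  enorm (a - y) <= m -> enorm (b - y) <= m -> enorm (x - y) <= m.
Proof.
move=> [t /= /andP[t0 t1] <-] am bm.
have m0 : 0 <= m by exact: le_trans (enorm_ge0 _) am.
move: am bm; rewrite !enorm_le_sqr// => am bm.
have -> : dotp ((1 - t) *: a + t *: b - y) ((1 - t) *: a + t *: b - y) =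
    (1 - t) * dotp (a - y) (a - y) + t * dotp (b - y) (b - y)
    - t * (1 - t) * dotp (a - b) (a - b).
  by rewrite !dotpE !mxE; ring.
have t1' : 0 <= 1 - t by rewrite subr_ge0.
have := ler_wpM2l t1' am; have := ler_wpM2l t0 bm.
have := mulr_ge0 (mulr_ge0 t0 t1') (dotp_ge0 (a - b)); lra.
Qed.

Definition spread P : R :=
  \big[Num.max/0]_(r < M.+1) \big[Num.max/0]_(s < M.+1 | (r < s)%N)
    enorm (P r - P s).

Lemma spread_ge0 P : 0 <= spread P.
Proof. exact: bigmax_ge_id. Qed.

Lemma spread_leP P m : 0 <= m ->
  reflect (forall r s : 'I_M.+1, (r < s)%N -> enorm (P r - P s) <= m)
          (spread P <= m).
Proof.
move=> m0; apply: (iffP (bigmax_leP _ _ _ _)) => [[_ h] r s rs|h].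
  by have /bigmax_leP[_] := h r isT; exact.
by split=> // r _; apply/bigmax_leP; split=> // s; exact: h.
Qed.

Lemma enorm_le_spread P r s : enorm (P r - P s) <= spread P.
Proof.
have lt_le (i j : 'I_M.+1) : (i < j)%N -> enorm (P i - P j) <= spread P.
  exact: (spread_leP P (spread_ge0 P) (lexx _)).
case: (ltngtP r s) => [|sr|/val_inj->]; first exact: lt_le.
  by rewrite enormBC lt_le.
by rewrite subrr enorm0 spread_ge0.
Qed.

Lemma with_origin0 p : with_origin p ord0 = 0.
Proof. by rewrite /with_origin unlift_none. Qed.

Lemma with_origin_lift p j : with_origin p (lift ord0 j) = p j.
Proof. by rewrite /with_origin liftK. Qed.

Lemma tour_segment (s : {perm 'I_M}) p x : tour s p x ->
  exists r r', segment (with_origin p r) (with_origin p r') x.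
Proof.
case=> [[k [_ kx]]|[[k [l [_ kx]]]|[k [_ kx]]]].
- by exists ord0, (lift ord0 (s k)); rewrite with_origin0 with_origin_lift.
- by exists (lift ord0 (s k)), (lift ord0 (s l)); rewrite !with_origin_lift.
- by exists (lift ord0 (s k)), ord0; rewrite with_origin0 with_origin_lift.
Qed.

Lemma tour_vertex (s : {perm 'I_M}) p r : (0 < M)%N ->
  tour s p (with_origin p r).
Proof.
move=> M0; case: (unliftP ord0 r) => [j|] ->.
  rewrite with_origin_lift -(permKV s j); set k := s^-1%g j.
  have [kM|kM] := ltnP k.+1 M.
    right; left; exists k, (Ordinal kM); split => //; exact: segmentl.
  right; right; exists k; split; last exact: segmentl.
  by apply/eqP; rewrite eqn_leq kM andbT.
rewrite with_origin0; left; exists (Ordinal M0); split => //; exact: segmentl.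
Qed.

(** Two points of the tour are no farther apart than some ends of their
    segments, and these ends are the origin or points p_j; conversely, every
    p_j and the origin lie on the tour as soon as it visits one point. *)
Lemma diam_tour (s : {perm 'I_M}) p : (0 < M)%N ->
  diam (tour s p) = spread (with_origin p).
Proof.
move=> M0; rewrite /diam; set S := (X in sup X).
have ubS : ubound S (spread (with_origin p)).
  move=> _ [x [y [/tour_segment[r [r' xr]] /tour_segment[t [t' yt]] ->]]].
  apply: (enorm_segment_le xr); rewrite enormBC;
    apply: (enorm_segment_le yt); exact: enorm_le_spread.
have memS r t : S (enorm (with_origin p r - with_origin p t)).
  by exists (with_origin p r), (with_origin p t); split=> //;
    exact: tour_vertex.
have supS : has_sup S.
  by split; [exists (enorm (with_origin p ord0 - with_origin p ord0));
    exact: memS|exists (spread (with_origin p))].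
have leS r t : enorm (with_origin p r - with_origin p t) <= sup S.
  by apply: sup_upper_bound => //; exact: memS.
apply/eqP; rewrite eq_le; apply/andP; split.
  by apply: ge_sup => //; exact: supS.1.
apply/spread_leP => [|r t _]; last exact: leS.
exact: le_trans (enorm_ge0 _) (leS ord0 ord0).
Qed.

Lemma tour_diametersE N : (0 < M)%N -> tour_diameters N = max_distances N.
Proof.
move=> M0; apply/seteqP; split=> [_ [s [p [Np ->]]]|_ [p [Np ->]]].
  by exists p; split=> //; rewrite diam_tour.
by exists 1%g, p; split=> //; rewrite diam_tour.
Qed.

(** * Attainment of the minimum *)

Section Attainment.
Import ArrowAsProduct.

Lemma with_origin_continuous (r : 'I_M.+1) :
  continuous (fun p : 'I_M -> 'cV[R]_2 => with_origin p r).
Proof.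
case: (unliftP ord0 r) => [j|] ->.
  have -> : (fun p : 'I_M -> 'cV[R]_2 => with_origin p (lift ord0 j)) =
      (fun p => p j) by apply/funext => p; exact: with_origin_lift.
  exact: (@proj_continuous _ (fun=> 'cV[R]_2) j).
have -> : (fun p : 'I_M -> 'cV[R]_2 => with_origin p ord0) = (fun=> 0).
  by apply/funext => p; exact: with_origin0.
exact: cst_continuous.
Qed.

Lemma max_continuous : continuous (fun z : R * R => Num.max z.1 z.2).
Proof.
by move=> z; apply: (@continuous_max R _ fst snd);
  [exact: cvg_fst|exact: cvg_snd].
Qed.

Lemma spread_continuous :
  continuous (fun p : 'I_M -> 'cV[R]_2 => spread (with_origin p)).
Proof.
apply: continuous_big => [|r _]; first exact: max_continuous.
apply: continuous_big => [|s _]; first exact: max_continuous.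
move=> p; apply: (@continuous_comp _ _ _
  (fun p : 'I_M -> 'cV[R]_2 => with_origin p r - with_origin p s) (@enorm R));
  last exact: enorm_continuous.
by apply: continuousB; exact: with_origin_continuous.
Qed.

(** The families of admissible points form a compact subset of the product space,
    by Tychonoff, and the spread is continuous on it. *)
Lemma spread_attained N : (forall j, compact (N j)) ->
    (forall j, N j !=set0) ->
  exists2 p, (forall j, N j (p j)) &
    forall p', (forall j, N j (p' j)) ->
      spread (with_origin p) <= spread (with_origin p').
Proof.
move=> cN N0; have [p0 Np0] := choice N0.
have := @compact_EVT_min _ R (fun p => spread (with_origin p))
  [set p | forall j, N j (p j)].
case=> [|||p /set_mem Np pmin].
- by exists p0.
- exact: (@tychonoff _ (fun=> 'cV[R]_2)).
- by apply: continuous_subspaceT => p; exact: spread_continuous.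
- by exists p => // p' Np'; apply: pmin; exact/mem_set.
Qed.

End Attainment.

End Spread.

(** * Neighborhoods as unions of segments *)

Section Neighborhoods.
Context {R : realType} {q : nat}.

Lemma segment_compact (a b : 'cV[R]_2) : compact (segment a b).
Proof.
have -> : segment a b = [set (1 - t) *: a + t *: b | t in `[0, 1]%classic].
  by rewrite /segment set_itvcc.
apply: continuous_compact; last exact: normed_module.segment_compact.
apply: continuous_subspaceT => t.
have left_end : {for t, continuous (fun t : R => (1 - t) *: a)}.
  apply: (@continuous_comp _ _ _ (fun t : R => 1 - t) (fun r => r *: a)).
    by apply: continuousB; [exact: cst_continuous|exact: cvg_id].
  exact: scalel_continuous.
exact: continuousD left_end (@scalel_continuous _ _ b t).
Qed.

Lemma neighborhoodE (F : set 'cV[R]_2) (v : 'I_q -> 'cV[R]_2)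
    (xi : 'cV[R]_2 * 'M[R]_2) : convex_polygon F v ->
  neighborhood F xi = \bigcup_k
    segment (xi.2^T *m (v k - xi.1)) (xi.2^T *m (v (ordS k) - xi.1)).
Proof.
move=> hF; rewrite /neighborhood (polygon_boundary hF).
have affine (x y : 'cV[R]_2) (t : R) :
    xi.2^T *m ((1 - t) *: x + t *: y - xi.1) =
    (1 - t) *: (xi.2^T *m (x - xi.1)) + t *: (xi.2^T *m (y - xi.1)).
  rewrite !scalemxAr -mulmxDr; congr (_ *m _).
  by apply: cV2P; rewrite !mxE; ring.
apply/seteqP; split=> [_ [_ [k _ [t t01 <-]] <-]|_ [k _ [t t01 <-]]].
  by exists k => //; exists t => //; rewrite -affine.
exists ((1 - t) *: v k + t *: v (ordS k)); last exact: affine.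
by exists k => //; exists t.
Qed.

Lemma neighborhood_compact (F : set 'cV[R]_2) (v : 'I_q -> 'cV[R]_2)
    (xi : 'cV[R]_2 * 'M[R]_2) : convex_polygon F v ->
  compact (neighborhood F xi).
Proof.
move=> hF; rewrite (neighborhoodE _ hF).
rewrite (_ : \bigcup_k _ = \bigcup_(k in [set` index_enum 'I_q])
    segment (xi.2^T *m (v k - xi.1)) (xi.2^T *m (v (ordS k) - xi.1))).
  by rewrite bigcup_seq; apply: bigsetU_compact => k _; exact: segment_compact.
by apply: eq_bigcupl; split=> k //= _; rewrite mem_index_enum.
Qed.

End Neighborhoods.

(** * The mixed-integer program *)

Section Selection.
Context {R : realType} {q : nat} (a b : 'I_q -> 'cV[R]_2).

Lemma binary_select (z lambda : 'I_q -> R) : \sum_k z k = 1 ->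
  (forall k, 0 <= lambda k <= z k) -> (forall k, z k = 0 \/ z k = 1) ->
  exists k, segment (a k) (b k)
    (\sum_i ((z i - lambda i) *: a i + lambda i *: b i)).
Proof.
move=> z1 lz zbin.
have [k zk] : exists k, z k = 1.
  apply: contrapT => none; have /eqP := z1; rewrite big1 ?(eq_sym 0) ?oner_eq0//.
  by move=> k _; case: (zbin k) => // zk; exfalso; apply: none; exists k.
have zi i : i != k -> z i = 0.
  move: z1; rewrite (bigD1 k)//= zk -[RHS]addr0 => /addrI.
  move=> /psumr_eq0P h ik; apply: h => // j _.
  by have /andP[/le_trans] := lz j; apply.
exists k; exists (lambda k); first by have := lz k; rewrite zk.
rewrite (bigD1 k)//= zk big1 ?addr0// => i ik.
have := lz i; rewrite zi// -eq_le => /eqP <-.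
by rewrite subrr !scale0r addr0.
Qed.

Lemma select_edge k (t : R) :
  \sum_i (((i == k)%:R - (i == k)%:R * t) *: a i + ((i == k)%:R * t) *: b i) =
  (1 - t) *: a k + t *: b k.
Proof.
rewrite (bigD1 k)//= eqxx !mul1r big1 ?addr0// => i /negbTE ->.
by rewrite !mul0r subrr !scale0r addr0.
Qed.

End Selection.

Section Program.
Context {R : realType} {M q : nat} (a b : 'I_M -> 'I_q -> 'cV[R]_2).

(** With M = 0 the cone constraints would be void and Delta could be negative;
    a neighborhood to visit forces Delta to be nonnegative. *)
Lemma misocp_valuesE : (0 < M)%N ->
  misocp_values a b = [set Delta | exists p : 'I_M -> 'cV[R]_2,
    (forall j, (\bigcup_k segment (a j k) (b j k)) (p j)) /\
    spread (with_origin p) <= Delta].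
Proof.
move=> M0; apply/seteqP; split=> [Delta|Delta [p [pN pD]]].
  move=> [P [z [lambda [P0 cone point select lz zbin]]]].
  have PE : with_origin (fun j => P (lift ord0 j)) = P.
    apply/funext => r; case: (unliftP ord0 r) => [j|] ->.
      by rewrite with_origin_lift.
    by rewrite with_origin0.
  exists (fun j => P (lift ord0 j)); split=> [j|].
    have [k kP] := binary_select (a j) (b j) (select j) (lz j) (zbin j).
    by exists k => //; rewrite point.
  have D0 : 0 <= Delta.
    exact: le_trans (enorm_ge0 _) (cone ord0 (lift ord0 (Ordinal M0)) isT).
  by rewrite PE; apply/spread_leP.
have /choice[k kP] : forall j, exists k, segment (a j k) (b j k) (p j).
  by move=> j; have [k _ kp] := pN j; exists k.
have /choice[t tP] : forall j, exists t : R, 0 <= t <= 1 /\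
    (1 - t) *: a j (k j) + t *: b j (k j) = p j.
  by move=> j; have [t t01 tp] := kP j; exists t.
exists (with_origin p), (fun j i => (i == k j)%:R),
  (fun j i => (i == k j)%:R * t j); split.
- exact: with_origin0.
- by move=> r s _; exact: le_trans (enorm_le_spread _ r s) pD.
- by move=> j; rewrite with_origin_lift select_edge (tP j).2.
- by move=> j; rewrite (bigD1 (k j))//= eqxx big1 ?addr0// => i /negbTE ->.
- move=> j i; have [/andP[t0 t1] _] := tP j.
  by case: (i == k j); rewrite ?mul1r ?mul0r ?t0 ?lexx.
- by move=> j i; case: (i == k j); [right|left].
Qed.

End Program.

(** * The optimal values agree *)

Lemma is_min_inf (R : realType) (A : set R) (m : R) : is_min A m -> inf A = m.
Proof.
move=> [Am mA]; apply/eqP; rewrite eq_le; apply/andP; split.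
  by apply: ge_inf => //; exists m.
by apply: lb_le_inf => //; exists m.
Qed.

(** Any x in F gives a point (x, 1) that some point of the net approximates. *)
Lemma net_nonempty (R : realType) (F : set 'cV[R]_2) (q : nat)
    (v : 'I_q -> 'cV[R]_2) (eta : R) (M : nat)
    (xi : 'I_M -> 'cV[R]_2 * 'M[R]_2) :
  convex_polygon F v -> finite_net F eta (range xi) -> (0 < M)%N.
Proof.
move=> hF [_ _ net]; have [x /interior_subset Fx] := polygon_interior hF.
have [|_ [j _ _] _] := net (x, 1%:M); last exact: leq_ltn_trans (ltn_ord j).
by split=> //=; rewrite /O2/= trmx1 mul1mx.
Qed.

Theorem mainTheorem6 (R : realType) (F : set 'cV[R]_2) (q : nat)
    (v : 'I_q -> 'cV[R]_2) (hF : convex_polygon F v)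
    (eta : R) (M : nat) (xi : 'I_M -> 'cV[R]_2 * 'M[R]_2)
    (hX : finite_net F eta (range xi)) :
  let N := fun j : 'I_M => neighborhood F (xi j) in
  let a := fun (j : 'I_M) (k : 'I_q) => (xi j).2^T *m (v k - (xi j).1) in
  let b := fun (j : 'I_M) (k : 'I_q) => (xi j).2^T *m (v (ordS k) - (xi j).1) in
  let D := min_diameter_value N in
  [/\ is_min (tour_diameters N) D,
      is_min (max_distances N) D
    & is_min (misocp_values a b) D].
Proof.
move=> N a b D; have M0 := net_nonempty hF hX.
have NE j : N j = \bigcup_k segment (a j k) (b j k) := neighborhoodE (xi j) hF.
have cN j : compact (N j) := neighborhood_compact (xi := xi j) hF.
have N0 j : N j !=set0.
  pose k := Ordinal (polygon_size_gt0 hF).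
  by exists (a j k); rewrite NE; exists k => //; exact: segmentl.
have [p Np pmin] := spread_attained cN N0.
have maxD : is_min (max_distances N) (spread (with_origin p)).
  by split=> [|_ [p' [Np' ->]]]; [exists p|exact: pmin].
have DE : D = spread (with_origin p).
  by rewrite /D /min_diameter_value tour_diametersE//; exact: is_min_inf.
rewrite DE tour_diametersE//; split=> //.
rewrite misocp_valuesE//; split=> [|Delta [p' [p'N p'D]]].
  by exists p; split=> // j; rewrite -NE.
by apply: le_trans p'D; apply: pmin => j; rewrite NE.
Qed.
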